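(* Let $b>0$, $0<\beta<2$, $0<\alpha\le\frac d2$, and let $x_1,\dots,x_n\in\mathbb{R}^d$ span $\mathbb{R}^d$ and satisfy $(d-2\alpha)\,|\{i:x_i\in L\}|<n\,d_L$ for every subspace $L\subset\mathbb{R}^d$ of dimension $1\le d_L<d$. Let $h(t)=(\frac d2-\alpha)t^{-1}+\frac{\beta}{b^\beta}t^{\beta-1}$ for $t>0$. Then the iteration $S_{k+1}=\frac2n\sum_{i=1}^nx_i\,h(x_i^TS_k^{-1}x_i)\,x_i^T$, started from any $S_0\in\mathbb{P}_d$, converges to the unique fixed point in $\mathbb{P}_d$ of the map $S\mapsto\frac2n\sum_{i=1}^nx_i\,h(x_i^TS^{-1}x_i)\,x_i^T$.
   Context: $\mathbb{P}_d$ denotes $d\times d$ real symmetric positive definite matrices. This is the fixed-point equation for maximum-likelihood estimation of the Kotz-type distribution with density generator $\varphi(t)=t^{\alpha-d/2}\exp(-(t/b)^\beta)$. *)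

(* Defs.v *)
From HB Require Import structures.
From mathcomp Require Import all_boot all_order all_algebra.
From mathcomp Require Import all_classical all_reals all_analysis.
Set Implicit Arguments. Unset Strict Implicit. Unset Printing Implicit Defensive.
Import Order.TTheory GRing.Theory Num.Theory numFieldNormedType.Exports.
Local Open Scope classical_set_scope.
Local Open Scope ring_scope.

Definition posdef (R : realType) (d : nat) (S : 'M[R]_d) : Prop :=
  S^T = S /\ forall v : 'rV[R]_d, v != 0 -> 0 < (v *m S *m v^T) 0 0.

Definition kotz_h (R : realType) (d : nat) (alpha beta b : R) (t : R) : R :=
  (d%:R / 2 - alpha) * t^-1 + beta / (b `^ beta) * t `^ (beta - 1).

(* Fixed-point map S |-> 2/n sum_i x_i h(x_i^T S^{-1} x_i) x_i^T ;
   data points x_i are stored as row vectors, so x_i x_i^T becomes (x i)^T *m x i. *)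
Definition kotz_map (R : realType) (d n : nat) (alpha beta b : R)
  (x : 'I_n -> 'rV[R]_d) (S : 'M[R]_d) : 'M[R]_d :=
  (2 / n%:R) *: \sum_(i < n)
     (kotz_h d alpha beta b ((x i *m invmx S *m (x i)^T) 0 0) *: ((x i)^T *m x i)).

Definition mx_cvg_to (R : realType) (d : nat) (u : nat -> 'M[R]_d) (L : 'M[R]_d) : Prop :=
  forall i j : 'I_d, (fun k => u k i j) @ \oo --> L i j.

(* Main.v *)
(* Order symmetric matrices by their quadratic forms. If [S <= lam S'] and
   [S' <= lam S] then the quantities [x_i^T S^-1 x_i] and [x_i^T S'^-1 x_i] differ at
   most by the factor [lam], and [h] has elasticity in [[-1, beta - 1]], so the
   fixed-point map does not increase [lam]: it is nonexpansive for Thompson's metric.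
   The elasticity stays away from [-1] when its argument is bounded below, so in the
   presence of a fixed point [lam - 1] decays geometrically along every orbit, which
   gives convergence and uniqueness.

   For existence replace [t^-1] by [t^-(1 - e)]: the map becomes a strict contraction
   and has approximate fixed points [S_e]. Their inverses are bounded because each
   weight [t h(t)] is at most [n] and the data span, so they accumulate at some
   positive semidefinite [Q] as [e] goes to 0. If [Q] is invertible, then its inverse
   is a fixed point. Otherwise the trace of the fixed-point equation compressed to the
   kernel [L] of [Q] yields [n dim L <= (d - 2 alpha) #{i | x_i in L}]. *)
Require Import Defs.
From HB Require Import structures.
From mathcomp Require Import all_boot all_order all_algebra.
From mathcomp Require Import all_classical all_reals all_analysis.
From mathcomp Require Import ring lra.
Import Order.TTheory GRing.Theory Num.Theory numFieldNormedType.Exports.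
Set Implicit Arguments.
Unset Strict Implicit.
Unset Printing Implicit Defensive.
Local Open Scope ring_scope.

(** * Quadratic forms of positive definite matrices and the order they induce *)

Section QuadraticForms.
Variables (R : realType) (d : nat).
Implicit Types (M N P : 'M[R]_d) (u v w : 'rV[R]_d).

Definition bform M u v : R := (u *m M *m v^T) 0 0.

Definition psd M := M^T = M /\ forall v, 0 <= bform M v v.

Definition dominated lam M N := forall v, bform M v v <= lam * bform N v v.

Lemma bformDl M u v w : bform M (u + v) w = bform M u w + bform M v w.
Proof. by rewrite /bform !mulmxDl mxE. Qed.

Lemma bformDr M u v w : bform M u (v + w) = bform M u v + bform M u w.
Proof. by rewrite /bform linearD mulmxDr mxE. Qed.

Lemma bformZl M c u v : bform M (c *: u) v = c * bform M u v.
Proof. by rewrite /bform -!scalemxAl mxE. Qed.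

Lemma bformZr M c u v : bform M u (c *: v) = c * bform M u v.
Proof. by rewrite /bform linearZ -scalemxAr mxE. Qed.

Lemma bform_sym M u v : M^T = M -> bform M u v = bform M v u.
Proof.
move=> sM; have -> : bform M u v = (u *m M *m v^T)^T 0 0 by rewrite mxE.
by rewrite !trmx_mul trmxK sM mulmxA.
Qed.

Lemma bform_mulmxl M N u v : bform M (u *m N) v = bform (N *m M) u v.
Proof. by rewrite /bform !mulmxA. Qed.

Lemma bform_mulmxr M N u v : bform M u (v *m N) = bform (M *m N^T) u v.
Proof. by rewrite /bform trmx_mul !mulmxA. Qed.

Lemma bform_addl M N u v : bform (M + N) u v = bform M u v + bform N u v.
Proof. by rewrite /bform mulmxDr mulmxDl mxE. Qed.

Lemma bform_scale M c u v : bform (c *: M) u v = c * bform M u v.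
Proof. by rewrite /bform -scalemxAr -scalemxAl mxE. Qed.

Lemma dotC u v : (u *m v^T) 0 0 = (v *m u^T) 0 0.
Proof. by rewrite -[in RHS](trmxK (v *m u^T)) trmx_mul trmxK [RHS]mxE. Qed.

Lemma bform_rank1 u v w : bform (u^T *m u) v w = (v *m u^T) 0 0 * (w *m u^T) 0 0.
Proof.
rewrite /bform mulmxA -[_ *m u *m _]mulmxA mxE big_ord1; congr (_ * _).
exact: dotC.
Qed.

Lemma bform_delta M i j : bform M (delta_mx 0 i) (delta_mx 0 j) = M i j.
Proof. by rewrite /bform -rowE trmx_delta -colE !mxE. Qed.

Lemma posdef_psd M : posdef M -> psd M.
Proof.
case=> sM pM; split=> // v; have [->|v0] := eqVneq v 0.
  by rewrite /bform !mul0mx mxE.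
exact/ltW/pM.
Qed.

Lemma posdef_unit M : posdef M -> M \in unitmx.
Proof.
case=> _ pM; rewrite -row_free_unit -kermx_eq0; apply/eqP/eqP.
apply: contraT => /rowV0Pn[v /sub_kermxP vM v0].
by have := pM v v0; rewrite vM mul0mx mxE ltxx.
Qed.

Lemma trmx_invmx_sym M : M^T = M -> (invmx M)^T = invmx M.
Proof. by move=> sM; rewrite trmx_inv sM. Qed.

Lemma posdef_inv M : posdef M -> posdef (invmx M).
Proof.
move=> pM; have uM := posdef_unit pM; have [sM M_gt0] := pM.
split=> [|v v0]; first exact: trmx_invmx_sym.
have -> : v *m invmx M *m v^T = (v *m invmx M) *m M *m (v *m invmx M)^T.
  by rewrite trmx_mul trmx_invmx_sym// mulmxKV// mulmxA.
apply: M_gt0; apply: contraNneq v0 => vM.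
by rewrite -(mulmxKV uM v) vM mul0mx.
Qed.

(** [M] is only semidefinite, so [bform M u u] may vanish. Both cases come from the sign of the form
    at [s *: u + t *: v] for suitable [s] and [t]. *)
Lemma psd_CauchySchwarz M u v : psd M ->
  bform M u v ^+ 2 <= bform M u u * bform M v v.
Proof.
move=> [sM M_ge0].
have H s t : 0 <= s ^+ 2 * bform M u u + 2 * s * t * bform M u v
    + t ^+ 2 * bform M v v.
  have := M_ge0 (s *: u + t *: v).
  rewrite bformDl !bformDr !bformZl !bformZr (bform_sym _ _ sM).
  by move/le_trans; apply; rewrite le_eqVlt; apply/orP; left; apply/eqP; ring.
set a := bform M u u in H *; set b := bform M u v in H *.
set c := bform M v v in H *.
have a0 : 0 <= a by exact: M_ge0.
have c0 : 0 <= c by exact: M_ge0.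
have [a_eq0|an0] := eqVneq a 0.
  have [->|b0] := eqVneq b 0; first by rewrite expr0n /= mulr_ge0.
  (* With [a = 0] and [t = 1] the polynomial is [2 * s * b + c]; this [s] makes it [-1]. *)
  have := H (- (c + 1) / (2 * b)) 1; rewrite a_eq0.
  have -> : (- (c + 1) / (2 * b)) ^+ 2 * 0 + 2 * (- (c + 1) / (2 * b)) * 1 * b
      + 1 ^+ 2 * c = -1 by field.
  by rewrite oppr_ge0 ler10.
have a_gt0 : 0 < a by rewrite lt_neqAle eq_sym an0.
have := H (- b) a.
have -> : (- b) ^+ 2 * a + 2 * - b * a * b + a ^+ 2 * c = a * (a * c - b ^+ 2) by ring.
by rewrite pmulr_rge0// subr_ge0.
Qed.

Lemma psd_isotropic M u : psd M -> bform M u u = 0 -> u *m M = 0.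
Proof.
move=> psdM u0; apply/matrixP => i j; rewrite ord1 [RHS]mxE.
have := psd_CauchySchwarz u (delta_mx 0 j) psdM; rewrite u0 mul0r.
rewrite real_exprn_even_le0 ?num_real//= => /eqP <-.
by rewrite /bform trmx_delta -colE !mxE.
Qed.

(** No diagonalization: with [z = v M^-1] and [y = v N^-1], expand the [M]-form of [lam *: z - y],
    which is nonnegative, and bound its term [bform M y y] by [lam * bform N y y]. *)
Lemma dominated_invmx lam M N : 0 < lam -> posdef M -> posdef N ->
  dominated lam M N -> dominated lam (invmx N) (invmx M).
Proof.
move=> lam0 pM pN MN v.
have uM := posdef_unit pM; have uN := posdef_unit pN.
have [[sM _] [sN _]] := (pM, pN).
pose y := v *m invmx N; pose z := v *m invmx M.
have [_ /(_ (lam *: z + (-1) *: y))] := posdef_psd pM.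
rewrite bformDl !bformDr !bformZl !bformZr.
have -> : bform M z z = bform (invmx M) v v.
  by rewrite /z bform_mulmxl bform_mulmxr trmx_invmx_sym// mulmxK// mulVmx// mul1mx.
have yz : bform M y z = bform (invmx N) v v.
  by rewrite /y /z bform_mulmxl bform_mulmxr trmx_invmx_sym// mulmxK.
rewrite (bform_sym z y sM) yz => H.
have := MN y; have -> : bform N y y = bform (invmx N) v v.
  by rewrite /y bform_mulmxl bform_mulmxr trmx_invmx_sym// mulmxK// mulVmx// mul1mx.
move=> H1.
suff : 0 <= lam * (lam * bform (invmx M) v v - bform (invmx N) v v).
  by rewrite pmulr_rge0// subr_ge0.
clear -lam0 H H1; nra.
Qed.

End QuadraticForms.

(** * Traces of products, and comparability of positive definite matrices *)

Section TraceInequality.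
Variables (R : realType) (d : nat).
Implicit Types (M N P : 'M[R]_d) (u v w : 'rV[R]_d).

(* Each step splits off a rank one matrix and kills a nonzero row of [N]. *)
Lemma mxtrace_psd_ge0 P N : (forall v, 0 <= bform P v v) -> psd N ->
  0 <= \tr (P *m N).
Proof.
move=> P_ge0.
have [m] := ubnP #|[set i | row i N != 0]|.
elim: m N => // m IHm N; rewrite ltnS => Nm psdN.
have [/existsP[i Ni]|/existsPn N0] := boolP [exists i, row i N != 0]; last first.
  suff -> : N = 0 by rewrite mulmx0 mxtrace0.
  by apply/row_matrixP => i; rewrite row0; apply/eqP/negPn/N0.
have [sN N_ge0] := psdN.
have bi v : bform N (delta_mx 0 i) v = (v *m (row i N)^T) 0 0.
  by rewrite /bform -rowE dotC.
have Nii_gt0 : 0 < N i i.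
  rewrite -(bform_delta N) lt_neqAle N_ge0 andbT eq_sym.
  apply: contraNneq Ni => /(psd_isotropic psdN).
  by rewrite -rowE => ->.
(* A Schur complement: row and column [i] vanish, Cauchy-Schwarz keeps it semidefinite, and symmetry
   of [N] keeps its zero rows zero. *)
pose N' := N + (- (N i i)^-1) *: ((row i N)^T *m row i N).
have trN : \tr (P *m N) = \tr (P *m N') + (N i i)^-1 * bform P (row i N) (row i N).
  have NE : N = N' + (N i i)^-1 *: ((row i N)^T *m row i N).
    by rewrite /N' -addrA -scalerDl addNr scale0r addr0.
  rewrite [in LHS]NE mulmxDr linearD /= -scalemxAr linearZ /=; congr (_ + _ * _).
  rewrite mulmxA mxtrace_mulC mulmxA /bform.
  by rewrite [LHS]/mxtrace big_ord1.
rewrite trN addr_ge0//; last by rewrite mulr_ge0// invr_ge0 ltW.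
have psdN' : psd N'.
  split=> [|v].
    by rewrite /N' linearD linearZ /= trmx_mul trmxK sN.
  rewrite bform_addl bform_scale bform_rank1 -bi.
  have := psd_CauchySchwarz (delta_mx 0 i) v psdN.
  rewrite bform_delta => H; rewrite mulNr subr_ge0.
  by rewrite ler_pdivrMl// -expr2.
apply: IHm => //; apply: leq_trans Nm; apply: proper_card.
apply/properP; split.
  apply/fintype.subsetP => j; rewrite !inE; apply: contraNneq => Nj.
  have Nji : N j i = 0 by move/rowP/(_ i): Nj; rewrite !mxE.
  have Nij : N i j = 0 by rewrite -sN mxE.
  apply/eqP/rowP => k; move/rowP/(_ k): Nj.
  by rewrite !mxE big_ord1 !mxE Nij mul0r mulr0 addr0.
exists i; rewrite inE// negbK; apply/eqP/rowP => k.
by rewrite !mxE big_ord1 !mxE mulNr mulKf ?subrr// gt_eqF.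
Qed.

(** The trace stands in for the largest generalized eigenvalue. By Cauchy-Schwarz for [N^-1], the
    matrix [N^-1 - v^T v / bform N v v] has a nonnegative form; pair it with [M]. *)
Lemma dominated_mxtrace M N : psd M -> posdef N ->
  dominated (\tr (invmx N *m M)) M N.
Proof.
move=> psdM pN v; have [->|v0] := eqVneq v 0.
  by rewrite /bform !mul0mx mxE mulr0.
have [sN N_gt0] := pN; have uN := posdef_unit pN.
have psdNi := posdef_psd (posdef_inv pN).
have Nv_gt0 : 0 < bform N v v by exact: N_gt0.
pose P := invmx N + (- (bform N v v)^-1) *: (v^T *m v).
have P_ge0 y : 0 <= bform P y y.
  rewrite bform_addl bform_scale bform_rank1 mulNr subr_ge0 ler_pdivrMl// -expr2.
  have := psd_CauchySchwarz (v *m N) y psdNi.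
  rewrite !bform_mulmxl bform_mulmxr sN mulmxV// mul1mx.
  by congr (_ ^+ 2 <= _); rewrite /bform mulmx1 dotC.
have := mxtrace_psd_ge0 P_ge0 psdM.
rewrite mulmxDl linearD /= -scalemxAl linearZ /= mulNr subr_ge0.
rewrite ler_pdivrMl// mulrC.
by congr (_ <= _); rewrite -mulmxA mxtrace_mulC [LHS]/mxtrace big_ord1.
Qed.

Lemma dominatedW lam mu M N : psd N -> lam <= mu ->
  dominated lam M N -> dominated mu M N.
Proof.
move=> [_ N_ge0] lm MN v; apply: le_trans (MN v) _.
by rewrite ler_wpM2r.
Qed.

Lemma posdef_equiv M N : posdef M -> posdef N ->
  exists2 lam, 1 <= lam & dominated lam M N /\ dominated lam N M.
Proof.
move=> pM pN; have [psdM psdN] := (posdef_psd pM, posdef_psd pN).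
exists (Num.max 1 (Num.max (\tr (invmx N *m M)) (\tr (invmx M *m N)))).
  by rewrite le_max lexx.
split; apply: dominatedW (dominated_mxtrace _ _) => //.
  by rewrite !le_max lexx orbT.
by rewrite !le_max lexx !orbT.
Qed.

Lemma posdef1 : posdef (1%:M : 'M[R]_d).
Proof.
split=> [|v v0]; first exact: trmx1.
rewrite mulmx1 mxE lt_neqAle eq_sym sumr_ge0 ?andbT; last first.
  by move=> j _; rewrite mxE -expr2 sqr_ge0.
apply: contraNneq v0 => /eqP; rewrite psumr_eq0; last first.
  by move=> j _; rewrite mxE -expr2 sqr_ge0.
move=> /allP v0; apply/eqP/rowP => j.
have := v0 j (mem_index_enum _); rewrite /= [_ ^T _ _]mxE -expr2 sqrf_eq0.
by move=> /eqP ->; rewrite mxE.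
Qed.

Lemma bform_polarization M i j : M^T = M ->
  M i j = (bform M (delta_mx 0 i + delta_mx 0 j) (delta_mx 0 i + delta_mx 0 j)
   - bform M (delta_mx 0 i - delta_mx 0 j) (delta_mx 0 i - delta_mx 0 j)) / 4.
Proof.
move=> sM; rewrite -[- delta_mx 0 j]scaleN1r !bformDl !bformDr !bformZl !bformZr.
rewrite (bform_sym (delta_mx 0 j) (delta_mx 0 i))// !bform_delta.
by clear sM; lra.
Qed.

End TraceInequality.

(** * Compression of a positive definite matrix to a subspace *)

Section Compression.
Variables (R : realType) (d r : nat) (S : 'M[R]_d) (B : 'M[R]_(r, d)).
Hypotheses (pS : posdef S) (freeB : row_free B).

Let K := B *m S *m B^T.

(* [S^(1/2) *m compression *m S^(1/2)] is the orthogonal projection onto the image of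
   the row space of [B] under [S^(1/2)]. *)
Definition compression := B^T *m invmx K *m B.

Lemma posdef_gram : posdef K.
Proof.
have [sS S_gt0] := pS.
split; first by rewrite /K !trmx_mul trmxK sS mulmxA.
move=> v v0; have -> : v *m K *m v^T = (v *m B) *m S *m (v *m B)^T.
  by rewrite trmx_mul !mulmxA.
apply: S_gt0; apply: contraNneq v0 => vB.
by apply/eqP/(row_free_inj freeB); rewrite mul0mx.
Qed.

Let uK := posdef_unit posdef_gram.
Let sK : (invmx K)^T = invmx K.
Proof. by have [] := posdef_inv posdef_gram. Qed.

Lemma compression_sym : compression^T = compression.
Proof. by rewrite /compression !trmx_mul trmxK sK mulmxA. Qed.

Lemma compression_ge0 v : 0 <= bform compression v v.
Proof.
have [_ /(_ (v *m B^T))] := posdef_psd (posdef_inv posdef_gram).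
by rewrite /bform trmx_mul trmxK /compression !mulmxA.
Qed.

(** The difference [D] of the two matrices is symmetric with [D S D = D], so its form at [v] is the
    form of [S] at [v *m D]. *)
Lemma compression_le v : bform compression v v <= bform (invmx S) v v.
Proof.
have [sS _] := pS; have uS := posdef_unit pS.
have ASA : compression *m S *m compression = compression.
  have -> : compression *m S *m compression
      = B^T *m (invmx K *m K *m invmx K) *m B.
    by rewrite /compression /K !mulmxA.
  by rewrite mulVmx// mul1mx.
pose D := invmx S - compression.
have DSD : D *m S *m D^T = D.
  rewrite /D linearB /= compression_sym trmx_invmx_sym// mulmxBl mulVmx//.
  rewrite mulmxBl mul1mx !mulmxBr mulmxK// ASA subrr subr0.
  by [].
have [_ /(_ (v *m D))] := posdef_psd pS.
rewrite bform_mulmxl bform_mulmxr DSD /D -scaleN1r bform_addl bform_scale.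
by rewrite mulN1r subr_ge0.
Qed.

Lemma mxtrace_compression M :
  \tr (compression *m M) = \tr (invmx K *m (B *m M *m B^T)).
Proof. by rewrite /compression -!mulmxA mxtrace_mulC !mulmxA. Qed.

Lemma mxtrace_compression_self : \tr (compression *m S) = r%:R.
Proof. by rewrite mxtrace_compression mulVmx// mxtrace1. Qed.

Lemma compression_orth v w : B *m w^T = 0 ->
  bform compression (v + w) (v + w) = bform compression v v.
Proof.
move=> Bw.
have A0 u : bform compression u w = 0.
  by rewrite /bform /compression -!mulmxA Bw !mulmx0 mxE.
by rewrite bformDl !bformDr !A0 (bform_sym w v) ?compression_sym// A0 !addr0.
Qed.

End Compression.

(** * Scalar estimates for the weight function *)

Section ScalarWeights.
Variable R : realType.
Implicit Types (a c lam s t : R).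

Lemma powR_le1D lam c : 1 <= lam -> 0 <= c <= 1 -> lam `^ c <= 1 + c * (lam - 1).
Proof.
move=> lam1 /andP[c_ge0 c_le1]; have lam0 : 0 < lam by lra.
have [c0|cn0] := eqVneq c 0; first by rewrite c0 powRr0 mul0r addr0.
have [c1|cn1] := eqVneq c 1.
  by rewrite c1 (powRr1 (ltW lam0)); lra.
have c_gt0 : 0 < c by rewrite lt_neqAle eq_sym cn0.
have c_lt1 : 0 < 1 - c by rewrite subr_gt0 lt_neqAle cn1.
have := @conjugate_powR R (lam `^ c) 1 c^-1 (1 - c)^-1.
rewrite -powRrM mulfV// (powRr1 (ltW lam0)) powR1 mulr1 !invrK.
move=> /(_ (powR_ge0 _ _) ler01); rewrite !invr_gt0 => /(_ c_gt0 c_lt1) H.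
have /H : c + (1 - c) = 1 by lra.
by move/le_trans; apply; lra.
Qed.

Lemma powR_ratio lam s t a c : 0 < s -> 0 < t -> 1 <= lam ->
  s <= lam * t -> t <= lam * s -> `|a| <= c -> s `^ a <= lam `^ c * t `^ a.
Proof.
move=> s0 t0 lam1 st ts ac; have lam0 : 0 < lam by lra.
rewrite /powR !gt_eqF// -expRD ler_expR.
have H1 : ln s <= ln lam + ln t by rewrite -lnM ?posrE// ler_ln ?posrE ?mulr_gt0.
have H2 : ln t <= ln lam + ln s by rewrite -lnM ?posrE// ler_ln ?posrE ?mulr_gt0.
have l0 : 0 <= ln lam by rewrite ln_ge0.
have : a * (ln s - ln t) <= c * ln lam.
  apply: le_trans (ler_norm _) _; rewrite normrM ler_pM//.
  by rewrite ler_norml; apply/andP; split; lra.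
lra.
Qed.

(** At [gamma = 1] this is the Kotz weight, with [c1 = d / 2 - alpha] and [c2 = beta / b^beta];
    [gamma = 1 - e] is its regularization. *)
Definition reg_h (c1 c2 beta gamma t : R) : R :=
  c1 * t `^ (- gamma) + c2 * t `^ (beta - 1).

Variables (c1 c2 beta : R).
Hypotheses (c1_ge0 : 0 <= c1) (c2_gt0 : 0 < c2).
Hypotheses (beta_gt0 : 0 < beta) (beta_lt2 : beta < 2).

Lemma reg_h_gt0 gamma t : 0 < t -> 0 < reg_h c1 c2 beta gamma t.
Proof.
by move=> t0; rewrite /reg_h ltr_wpDl ?mulr_ge0 ?powR_ge0// mulr_gt0 ?powR_gt0.
Qed.

Lemma mul_reg_h gamma t : 0 < t ->
  t * reg_h c1 c2 beta gamma t = c1 * t `^ (1 - gamma) + c2 * t `^ beta.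
Proof.
move=> t0; have E r : t * t `^ r = t `^ (1 + r).
  by rewrite powRD ?(gt_eqF t0) ?implybT// powRr1// ltW.
by rewrite /reg_h mulrDr !(mulrCA t) !E [1 + (beta - 1)]addrC subrK.
Qed.

Lemma reg_h_contraction gamma c lam s t : 0 <= gamma -> gamma <= c ->
  `|beta - 1| <= c -> c <= 1 -> 0 < s -> 0 < t -> 1 <= lam ->
  s <= lam * t -> t <= lam * s ->
  reg_h c1 c2 beta gamma s <= (1 + c * (lam - 1)) * reg_h c1 c2 beta gamma t.
Proof.
move=> g0 gc bc c_le1 s0 t0 lam1 st ts.
have H : lam `^ c <= 1 + c * (lam - 1).
  by apply: powR_le1D => //; apply/andP; split=> //; apply: le_trans gc.
have gc' : `|- gamma| <= c by rewrite normrN ger0_norm.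
rewrite /reg_h mulrDr lerD// mulrCA ler_wpM2l ?(ltW c2_gt0)//.
  by apply: le_trans (powR_ratio s0 t0 lam1 st ts gc') _; rewrite ler_wpM2r ?powR_ge0.
by apply: le_trans (powR_ratio s0 t0 lam1 st ts bc) _; rewrite ler_wpM2r ?powR_ge0.
Qed.

(* Elasticity [-1] of the singular part is compensated by the second part,
   whose share of the total weight is at least [theta] on [[m, +oo[]. *)
Lemma reg_h1_contraction m : 0 < m -> exists2 q, 0 <= q < 1 &
  forall lam s t, m <= s -> m <= t -> 1 <= lam -> s <= lam * t -> t <= lam * s ->
    reg_h c1 c2 beta 1 s <= (1 + q * (lam - 1)) * reg_h c1 c2 beta 1 t.
Proof.
move=> m0; pose k := `|beta - 1|.
have k_ge0 : 0 <= k by exact: normr_ge0.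
have k_lt1 : k < 1.
  by rewrite ltr_norml ltrBlDr ltrBrDr addNr beta_gt0 -[1 + 1]/2.
have mb0 : 0 < m `^ beta by exact: powR_gt0.
have D0 : 0 < c1 + c2 * m `^ beta by rewrite ltr_wpDl// mulr_gt0.
(* The share of the second term at [t = m]; this share increases with [t]. *)
pose theta := c2 * m `^ beta / (c1 + c2 * m `^ beta).
have th0 : 0 < theta by rewrite divr_gt0// mulr_gt0.
have th1 : theta <= 1 by rewrite ler_pdivrMr// mul1r lerDr.
have k1_gt0 : 0 < 1 - k by rewrite subr_gt0.
(* The average of the rates [1] and [k] with weights [1 - theta] and [theta]. *)
exists (1 - theta * (1 - k)).
  rewrite subr_ge0 gtrDl oppr_lt0 mulr_gt0// andbT.
  by rewrite mulr_ile1 ?(ltW th0) ?(ltW k1_gt0)// gerBl.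
move=> lam s t ms mt lam1 st ts.
have [s0 t0] := (lt_le_trans m0 ms, lt_le_trans m0 mt).
rewrite /reg_h; set P' := c1 * s `^ _; set W' := c2 * s `^ _.
set P := c1 * t `^ _; set W := c2 * t `^ _.
have HP : P' <= lam * P.
  rewrite /P' /P mulrCA ler_wpM2l// -[X in X * _]powRr1 ?(le_trans ler01)//.
  by apply: powR_ratio => //; rewrite normrN1.
have HW : W' <= (1 + k * (lam - 1)) * W.
  rewrite /W' /W mulrCA ler_wpM2l ?(ltW c2_gt0)//.
  apply: le_trans (powR_ratio s0 t0 lam1 st ts (lexx k)) _.
  by rewrite ler_wpM2r ?powR_ge0// powR_le1D// k_ge0 ltW.
have Wt : W = c2 * t `^ beta / t.
  by rewrite /W -mulrA -(powR_inv1 (ltW t0)) -powRD ?(gt_eqF t0) ?implybT.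
have Pt : P = c1 / t by rewrite /P (powR_inv1 (ltW t0)).
have share : theta * (P + W) <= W.
  rewrite Wt Pt -mulrDl mulrA ler_pM2r ?invr_gt0//.
  rewrite /theta mulrAC ler_pdivrMr// -!mulrA ler_pM2l// !mulrDr mulrC.
  have : m `^ beta <= t `^ beta.
    by apply: ge0_ler_powR; rewrite ?nnegrE // ltW.
  move: (m `^ beta) (t `^ beta) c1_ge0 => x y c10 xy; nra.
apply: le_trans (lerD HP HW) _; rewrite -subr_ge0.
have -> : (1 + (1 - theta * (1 - k)) * (lam - 1)) * (P + W)
   - (lam * P + (1 + k * (lam - 1)) * W)
   = (lam - 1) * ((1 - k) * (W - theta * (P + W))) by ring.
by rewrite !mulr_ge0// ?subr_ge0// ltW.
Qed.

End ScalarWeights.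

(** * Weighted scatter matrices and their iteration *)

Section WeightedScatter.
Variables (R : realType) (d n : nat) (x : 'I_n -> 'rV[R]_d).
Hypothesis rank_x : \rank (\matrix_(i < n) x i) = d.
Implicit Types (S M N : 'M[R]_d) (v w : 'rV[R]_d) (g : R -> R).

(** A general weight [g] covers the Kotz map, its regularizations, and the plain scatter matrix of
    the data ([g] constant 1). *)
Definition scatter g S : 'M[R]_d :=
  (2 / n%:R) *: \sum_(i < n) (g (bform (invmx S) (x i) (x i)) *: ((x i)^T *m x i)).

Lemma bform_sum (I : finType) (F : I -> 'M[R]_d) v w :
  bform (\sum_i F i) v w = \sum_i bform (F i) v w.
Proof. by rewrite /bform mulmx_sumr mulmx_suml summxE. Qed.

Lemma bform_scatter g S v w : bform (scatter g S) v w = 2 / n%:R *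
  \sum_i g (bform (invmx S) (x i) (x i)) * ((v *m (x i)^T) 0 0 * (w *m (x i)^T) 0 0).
Proof.
rewrite bform_scale bform_sum; congr (_ * _); apply: eq_bigr => i _.
by rewrite bform_scale bform_rank1.
Qed.

Lemma mxtrace_mul_scatter g S M : \tr (M *m scatter g S) = 2 / n%:R *
  \sum_i g (bform (invmx S) (x i) (x i)) * bform M (x i) (x i).
Proof.
rewrite -scalemxAr linearZ /= mulmx_sumr linear_sum /=; congr (_ * _).
apply: eq_bigr => i _; rewrite -scalemxAr linearZ /= mulmxA mxtrace_mulC mulmxA.
by congr (_ * _); rewrite /mxtrace big_ord1.
Qed.

Lemma scatter_sym g S : (scatter g S)^T = scatter g S.
Proof.
rewrite linearZ /= linear_sum /=; congr (_ *: _); apply: eq_bigr => i _.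
by rewrite linearZ /= trmx_mul trmxK.
Qed.

Lemma span_dot v : v != 0 -> exists i, (v *m (x i)^T) 0 0 != 0.
Proof.
move=> v0; apply/existsP; apply: contraNT v0 => /existsPn v0.
have fX : row_free (\matrix_(i < n) x i)^T by rewrite /row_free mxrank_tr rank_x.
apply/eqP/(row_free_inj fX); rewrite mul0mx; apply/rowP => i.
have /negPn/eqP := v0 i; rewrite !mxE => vi; rewrite -[RHS]vi.
by apply: eq_bigr => j _; rewrite !mxE.
Qed.

Lemma invmx_form_gt0 S i : posdef S -> x i != 0 -> 0 < bform (invmx S) (x i) (x i).
Proof. by move=> /posdef_inv[_ +] => /[apply]. Qed.

Lemma posdef_scatter g S : (forall t, 0 < t -> 0 < g t) -> posdef S ->
  posdef (scatter g S).
Proof.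
move=> g0 pS; split=> [|v v0]; first exact: scatter_sym.
have [i vi] := span_dot v0.
have n0 : 0 < n%:R :> R by rewrite ltr0n (leq_ltn_trans _ (ltn_ord i)).
rewrite -/(bform _ v v) bform_scatter mulr_gt0 ?divr_gt0//.
(* At [x j = 0] the weight is evaluated at 0, where its sign is unknown, but the dot product then
   vanishes. *)
have dot0 j : (v *m (x j)^T) 0 0 != 0 -> 0 < g (bform (invmx S) (x j) (x j)).
  move=> vj; apply/g0/invmx_form_gt0 => //.
  by apply: contraNneq vj => ->; rewrite trmx0 mulmx0 mxE.
rewrite (bigD1 i)//= ltr_wpDr ?sumr_ge0//.
  move=> j _; have [->|vj] := eqVneq ((v *m (x j)^T) 0 0) 0.
    by rewrite mulr0 mulr0.
  by rewrite -expr2 mulr_ge0 ?sqr_ge0// ltW// dot0.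
by rewrite -expr2 mulr_gt0 ?dot0// lt_neqAle eq_sym sqrf_eq0 vi sqr_ge0.
Qed.

Lemma dominated_scatter g kappa S S' :
  (forall i, x i != 0 -> g (bform (invmx S) (x i) (x i))
     <= kappa * g (bform (invmx S') (x i) (x i))) ->
  dominated kappa (scatter g S) (scatter g S').
Proof.
move=> gk v; rewrite !bform_scatter mulrCA ler_wpM2l ?divr_ge0//.
rewrite mulr_sumr ler_sum// => i _; rewrite [leRHS]mulrA.
have [->|xi] := eqVneq (x i) 0; first by rewrite trmx0 mulmx0 mxE !mulr0.
by rewrite ler_wpM2r ?gk// -expr2 sqr_ge0.
Qed.

Lemma geometric_small q C eps : 0 <= q < 1 -> 0 < eps ->
  exists k, q ^+ k * C <= eps :> R.
Proof.
move=> /andP[q0 q1] e0.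
have q1' : `|q| < 1 by rewrite ger0_norm.
have : ((fun k => q ^+ k * C) @ \oo --> 0 * C)%classic.
  by apply: cvgMr_tmp; exact: cvg_expr.
rewrite mul0r => /cvgr_le /(_ _ e0) [k _ Hk].
by exists k; apply: Hk => /=.
Qed.

(** Consecutive iterates from the identity dominate each other up to [1 + q ^+ k * (lam - 1)], so a
    late iterate is the witness and no limit is taken. *)
Lemma scatter_approx_fixpoint g q eps : 0 <= q < 1 -> 0 < eps ->
  (forall t, 0 < t -> 0 < g t) ->
  (forall lam s t, 0 < s -> 0 < t -> 1 <= lam -> s <= lam * t -> t <= lam * s ->
     g s <= (1 + q * (lam - 1)) * g t) ->
  exists S, [/\ posdef S, dominated (1 + eps) (scatter g S) S &
                dominated (1 + eps) S (scatter g S)].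
Proof.
move=> q01 e0 g0 gq; have /andP[q0 q1] := q01.
pose u k := iter k (scatter g) (1%:M : 'M[R]_d).
have pu k : posdef (u k).
  elim: k => [|k IHk]; [exact: posdef1|exact: posdef_scatter].
have [lam lam1 [H1 H2]] := posdef_equiv (pu 1%N) (pu 0%N).
have C0 : 0 <= lam - 1 by rewrite subr_ge0.
have [k Hk] := geometric_small (lam - 1) q01 e0.
suff [D1 D2] : dominated (1 + q ^+ k * (lam - 1)) (u k.+1) (u k) /\
   dominated (1 + q ^+ k * (lam - 1)) (u k) (u k.+1).
  exists (u k); split=> //.
    by apply: dominatedW D1; [exact/posdef_psd/(pu k)|rewrite lerD2l].
  by apply: dominatedW D2; [exact/posdef_psd/(pu k.+1)|rewrite lerD2l].
elim: k {Hk} => [|k [IH1 IH2]]; first by rewrite expr0 mul1r addrC subrK.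
set mu := 1 + q ^+ k * (lam - 1) in IH1 IH2.
have mu1 : 1 <= mu by rewrite lerDl mulr_ge0// exprn_ge0.
have mu0 : 0 < mu by rewrite (lt_le_trans ltr01).
have -> : q ^+ k.+1 * (lam - 1) = q * (mu - 1) by rewrite /mu exprS; ring.
have step A B : posdef A -> posdef B -> dominated mu A B -> dominated mu B A ->
    dominated (1 + q * (mu - 1)) (scatter g A) (scatter g B).
  move=> pA pB AB BA; apply: dominated_scatter => i xi; apply: gq => //.
  - exact: invmx_form_gt0.
  - exact: invmx_form_gt0.
  - exact: (dominated_invmx mu0 pB pA BA).
  - exact: (dominated_invmx mu0 pA pB AB).
by split; [exact: (step _ _ (pu k.+1) (pu k))|exact: (step _ _ (pu k) (pu k.+1))].
Qed.

Lemma sum_inv_lower_bound (t : 'I_n -> R) : (forall i, 0 <= t i) ->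
  exists2 m, 0 < m & forall i, 0 < t i -> m <= t i.
Proof.
move=> t0; have s0 : 0 <= \sum_i (t i)^-1.
  by rewrite sumr_ge0// => i _; rewrite invr_ge0.
(* Vanishing [t i] contribute [0^-1 = 0]; the summand 1 keeps the bound positive when all vanish. *)
exists (1 + \sum_i (t i)^-1)^-1; first by rewrite invr_gt0 ltr_wpDr.
move=> i ti; rewrite invf_ple ?posrE ?ltr_wpDr//.
rewrite (bigD1 i)//= addrCA lerDl addr_ge0// sumr_ge0// => j _.
by rewrite invr_ge0.
Qed.

(** The orbit stays within the factor [lam] of the fixed point, which bounds the arguments of [g]
    below by [m / lam] along all of it. Hence one rate [q] serves every step. *)
Lemma scatter_iter_cvg g S S0 : posdef S -> posdef S0 -> scatter g S = S ->
  (forall t, 0 < t -> 0 < g t) ->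
  (forall m, 0 < m -> exists2 q, 0 <= q < 1 & forall lam s t, m <= s -> m <= t ->
     1 <= lam -> s <= lam * t -> t <= lam * s ->
     g s <= (1 + q * (lam - 1)) * g t) ->
  mx_cvg_to (fun k => iter k (scatter g) S0) S.
Proof.
move=> pS pS0 fS g0 gq.
pose u k := iter k (scatter g) S0.
have pu k : posdef (u k) by elim: k => // k IHk; exact: posdef_scatter.
have [lam lam1 [H1 H2]] := posdef_equiv pS0 pS.
have lam0 : 0 < lam by rewrite (lt_le_trans ltr01).
have [m m0 Hm] := sum_inv_lower_bound
  (fun i => (posdef_psd (posdef_inv pS)).2 (x i)).
have [q /andP[q0 q1] Hq] := gq (m / lam) (divr_gt0 m0 lam0).
have C0 : 0 <= lam - 1 by rewrite subr_ge0.
pose mu k := 1 + q ^+ k * (lam - 1).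
have mu1 k : 1 <= mu k by rewrite lerDl mulr_ge0// exprn_ge0.
have mu_gt0 k : 0 < mu k by rewrite (lt_le_trans ltr01).
have mu_lam k : mu k <= lam.
  by rewrite -lerBrDl ler_piMl// exprn_ile1// ltW.
have mlam : m / lam <= m by rewrite ler_pdivrMr// ler_peMr// ltW.
have D k : dominated (mu k) (u k) S /\ dominated (mu k) S (u k).
  elim: k => [|k [IH1 IH2]]; first by rewrite /mu expr0 mul1r addrC subrK.
  have E1 := dominated_invmx (mu_gt0 k) (pu _) pS IH1.
  have E2 := dominated_invmx (mu_gt0 k) pS (pu _) IH2.
  have -> : mu k.+1 = 1 + q * (mu k - 1) by rewrite /mu exprS; ring.
  have tS i : x i != 0 -> m <= bform (invmx S) (x i) (x i).
    by move=> xi; apply/Hm/invmx_form_gt0.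
  have tu i : x i != 0 -> m / lam <= bform (invmx (u k)) (x i) (x i).
    move=> xi; rewrite ler_pdivrMr//; apply: le_trans (tS i xi) _.
    apply: le_trans (E1 _) _; rewrite mulrC ler_wpM2l//.
    by have [_] := posdef_psd (posdef_inv (pu k)); apply.
  rewrite -fS; split; apply: dominated_scatter => i xi; rewrite ?fS;
    by apply: Hq => //; rewrite ?tu// (le_trans mlam)// tS.
have q1' : `|q| < 1 by rewrite ger0_norm.
have cmu : (mu k @[k --> \oo] --> (1 : R))%classic.
  rewrite -[X in (_ --> X)%classic]addr0 -(mul0r (lam - 1)).
  by apply: cvgD; [exact: cvg_cst|apply: cvgMr_tmp; exact: cvg_expr].
(* Squeeze the forms between multiples of the limit form; polarization then gives the entries. *)
have cu v : (bform (u k) v v @[k --> \oo] --> bform S v v)%classic.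
  apply: (@squeeze_cvgr _ _ _ _ (fun k => (mu k)^-1 * bform S v v)
    (fun k => mu k * bform S v v)).
  - near=> k; have [D1 D2] := D k; rewrite D1 andbT ler_pdivrMl//.
  - rewrite -[X in (_ --> X)%classic]mul1r -[X in X * _]invr1.
    by apply: cvgMr_tmp; apply: cvgV.
  - by rewrite -[X in (_ --> X)%classic]mul1r; apply: cvgMr_tmp.
move=> i j; rewrite (bform_polarization i j pS.1).
under eq_fun do rewrite -/(u _) (bform_polarization i j (pu _).1).
by apply: cvgMr_tmp; apply: cvgB.
Unshelve. all: by end_near.
Qed.

End WeightedScatter.

(** * Limits along filters, and trace bounds *)

Section FilterLimits.
Variable R : realType.

(** Compactness gives a cluster point, and an ultrafilter converges to its cluster points. This
    replaces extraction of subsequences for all matrix entries at once. *)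
Lemma ultra_bounded_cvg (U : set_system nat) (f : nat -> R) (M : R) :
  UltraFilter U -> (forall k, `|f k| <= M) ->
  exists l : R, (f @ U --> l)%classic.
Proof.
move=> UU fM.
have FU : U (f @^-1` `[- M, M])%classic.
  by apply: filterE => k /=; rewrite in_itv /= -ler_norml fM.
have [l [_ cl]] := @segment_compact _ _ _ _ (fmap_proper_filter f _) FU.
exists l => A lA; rewrite /fmap /=.
have [//|nA] := in_ultra_setVsetC (f @^-1` A)%classic UU.
have [y [/= ? ?]] : (~` A `&` A !=set0)%classic by apply: cl.
by [].
Qed.

Context {T : Type} {F : set_system T} {FF : Filter F}.

Lemma cvg_bigsum (I : finType) (f : I -> T -> R) (l : I -> R) :
  (forall i, (f i @ F --> l i)%classic) ->
  ((fun k => \sum_i f i k) @ F --> \sum_i l i)%classic.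
Proof.
move=> fl; elim: (index_enum I) => [|i r IHr].
  by rewrite big_nil; under eq_fun do rewrite big_nil; exact: cvg_cst.
by rewrite big_cons; under eq_fun do rewrite big_cons; exact: cvgD.
Qed.

Lemma powR_cvg0_ge0 (f : T -> R) (a : R) : 0 < a -> (forall k, 0 <= f k) ->
  (f @ F --> (0 : R))%classic -> ((fun k => f k `^ a) @ F --> (0 : R))%classic.
Proof.
move=> a0 f0 cf; apply/cvgrPdist_le => e e0.
have ea : 0 < e `^ a^-1 by rewrite powR_gt0.
near=> k; rewrite sub0r normrN ger0_norm ?powR_ge0//.
rewrite -[e](powRr1 (ltW e0)) -(mulVf (lt0r_neq0 a0)) powRrM.
apply: ge0_ler_powR; rewrite ?nnegrE ?powR_ge0 ?(ltW a0)//.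
by rewrite -[f k]ger0_norm//; near: k; exact: cvgr0_norm_le.
Unshelve. all: by end_near. Qed.

(** The exponent varies too, because the regularized exponent depends on the index. *)
Lemma cvg_powR (f g : T -> R) (a b : R) : 0 < a ->
  (f @ F --> a)%classic -> (g @ F --> b)%classic ->
  ((fun k => f k `^ g k) @ F --> a `^ b)%classic.
Proof.
move=> a0 fa gb; have f0 : \forall k \near F, expR (g k * ln (f k)) = f k `^ g k.
  near=> k; rewrite /powR gt_eqF//; near: k; exact: (cvgr_gt a).
apply: (cvg_trans (near_eq_cvg f0)).
rewrite /powR gt_eqF//; apply: continuous_cvg; first exact: continuous_expR.
apply: cvgM => //; apply: continuous_cvg => //; exact: continuous_ln.
Unshelve. all: by end_near. Qed.

Variable d : nat.
Implicit Types (u : T -> 'M[R]_d) (L : 'M[R]_d).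

Lemma bform_cvg u L v w : (forall i j, ((fun k => u k i j) @ F --> L i j)%classic) ->
  ((fun k => bform (u k) v w) @ F --> bform L v w)%classic.
Proof.
move=> uL; have E M : bform M v w = \sum_j \sum_i v 0 i * M i j * w 0 j.
  rewrite /bform mxE; apply: eq_bigr => j _.
  by rewrite !mxE mulr_suml.
rewrite E; under eq_fun do rewrite E.
apply: cvg_bigsum => j; apply: cvg_bigsum => i.
by apply: cvgMr_tmp; exact: cvgMl_tmp.
Qed.

End FilterLimits.

Lemma psd_entry_le_trace (R : realType) d (M : 'M[R]_d) i j : psd M ->
  `|M i j| <= \tr M.
Proof.
move=> psdM; have M_ge0 k : 0 <= M k k.
  by have [_ /(_ (delta_mx 0 k))] := psdM; rewrite bform_delta.
have Mtr k : M k k <= \tr M by rewrite /mxtrace (bigD1 k)//= lerDl sumr_ge0.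
have tr_ge0 : 0 <= \tr M by exact: le_trans (Mtr i).
rewrite -ler_sqr ?nnegrE//.
have := psd_CauchySchwarz (delta_mx 0 i) (delta_mx 0 j) psdM.
rewrite !bform_delta real_normK ?num_real// => /le_trans; apply.
by rewrite expr2 ler_pM.
Qed.

Lemma bform_inj (R : realType) d (M N : 'M[R]_d) : M^T = M -> N^T = N ->
  (forall v, bform M v v = bform N v v) -> M = N.
Proof.
move=> sM sN MN; apply/matrixP => i j.
by rewrite (bform_polarization i j sM) (bform_polarization i j sN) !MN.
Qed.

Lemma mxtrace_dominated (R : realType) d lam (P M N : 'M[R]_d) :
  (forall v, 0 <= bform P v v) -> M^T = M -> N^T = N -> dominated lam M N ->
  \tr (P *m M) <= lam * \tr (P *m N).
Proof.
move=> P_ge0 sM sN D; have psdD : psd (lam *: N + (-1) *: M).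
  split=> [|v]; first by rewrite linearD !linearZ /= sM sN.
  by rewrite bform_addl !bform_scale mulN1r subr_ge0.
have := mxtrace_psd_ge0 P_ge0 psdD.
by rewrite mulmxDr linearD /= -!scalemxAr !linearZ /= mulN1r subr_ge0.
Qed.

Lemma mxtrace_le_mul (R : realType) d (P W : 'M[R]_d) : psd P -> posdef W ->
  \tr P <= \tr (invmx W) * \tr (P *m W).
Proof.
move=> [_ P_ge0] pW; rewrite -{1}[P]mulmx1.
apply: mxtrace_dominated => //; [exact: trmx1|exact: pW.1|].
by have := dominated_mxtrace (posdef_psd (posdef1 R d)) pW; rewrite mulmx1.
Qed.

(** * Limits of approximate fixed points *)

Section ApproximateFixpoints.
Variables (R : realType) (d n : nat) (x : 'I_n -> 'rV[R]_d).
Hypothesis rank_x : \rank (\matrix_(i < n) x i) = d.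
Variables (c1 c2 beta : R).
Hypotheses (c1_ge0 : 0 <= c1) (c2_gt0 : 0 < c2).
Hypotheses (beta_gt0 : 0 < beta) (beta_lt2 : beta < 2).

(** Test the domination at [x i *m invmx S] and keep only the [i]-th summand: [2 / n * g t * t^2 <=
    (1 + eps) * t <= 2 * t]. *)
Lemma scatter_weight_le g eps S i : posdef S -> (forall t, 0 < t -> 0 < g t) ->
  eps <= 1 -> dominated (1 + eps) (scatter x g S) S -> x i != 0 ->
  bform (invmx S) (x i) (x i) * g (bform (invmx S) (x i) (x i)) <= n%:R.
Proof.
move=> pS g0 e1 D xi; have uS := posdef_unit pS.
have t0 := invmx_form_gt0 pS xi; set t := bform _ _ _ in t0 *.
have n0 : 0 < n%:R :> R by rewrite ltr0n (leq_ltn_trans _ (ltn_ord i)).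
have := D (x i *m invmx S).
have -> : bform S (x i *m invmx S) (x i *m invmx S) = t.
  by rewrite bform_mulmxl bform_mulmxr trmx_invmx_sym ?(pS.1)// mulVmx// mul1mx.
rewrite bform_scatter (bigD1 i)//= -/(bform (invmx S) (x i) (x i)) -/t => H.
have H1 : 2 / n%:R * (g t * (t * t)) <= (1 + eps) * t.
  apply: le_trans H; rewrite ler_wpM2l ?divr_ge0// lerDl sumr_ge0// => j _.
  have [->|xj] := eqVneq (x j) 0; first by rewrite trmx0 mulmx0 mxE !mulr0.
  by rewrite -expr2 mulr_ge0 ?sqr_ge0// ltW// g0// invmx_form_gt0.
have H2 : 2 / n%:R * (g t * (t * t)) <= 2 * t.
  by apply: le_trans H1 _; rewrite ler_pM2r// -lerBrDl (le_trans e1)//; lra.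
have -> : t * g t = 2 / n%:R * (g t * (t * t)) * (n%:R / (2 * t)).
  by field; rewrite !gt_eqF.
rewrite mulrA ler_pdivrMr ?mulr_gt0// [leRHS]mulrC ler_pM2r//.
Qed.

(** Since the data span, their plain scatter matrix is positive definite, and a multiple of it
    dominates the identity. *)
Lemma invmx_mxtrace_le S : posdef S -> \tr (invmx S) <=
  \tr (invmx (scatter x (fun=> 1) 1%:M)) *
    (2 / n%:R * \sum_i bform (invmx S) (x i) (x i)).
Proof.
move=> pS; have pW : posdef (scatter x (fun=> 1) 1%:M).
  by apply: posdef_scatter => //; exact: posdef1.
apply: le_trans (mxtrace_le_mul (posdef_psd (posdef_inv pS)) pW) _.
rewrite mxtrace_mul_scatter.
by under eq_bigr do rewrite mul1r.
Qed.

Variables (U : set_system nat) (e : nat -> R) (S : nat -> 'M[R]_d) (Q : 'M[R]_d).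
Context {PU : ProperFilter U}.
(** The same [e k] measures the regularization and the fixed-point error. *)
Let g k := reg_h c1 c2 beta (1 - e k).
Hypotheses (e_gt0 : forall k, 0 < e k) (e_le1 : forall k, e k <= 1).
Hypothesis (e_cvg : (e @ U --> (0 : R))%classic).
Hypothesis pS : forall k, posdef (S k).
Hypothesis domTS : forall k, dominated (1 + e k) (scatter x (g k) (S k)) (S k).
Hypothesis domST : forall k, dominated (1 + e k) (S k) (scatter x (g k) (S k)).
Hypothesis S_cvg : forall i j, ((fun k => invmx (S k) i j) @ U --> Q i j)%classic.

Let t k i := bform (invmx (S k)) (x i) (x i).

Let g_gt0 k s : 0 < s -> 0 < g k s.
Proof. exact: reg_h_gt0. Qed.

Let form_cvg v w : ((fun k => bform (invmx (S k)) v w) @ U --> bform Q v w)%classic.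
Proof. exact: bform_cvg. Qed.

Let psdQ : psd Q.
Proof.
split=> [|v].
  apply/matrixP => i j; rewrite mxE.
  have QE : (fun k => invmx (S k) j i) = (fun k => invmx (S k) i j).
    by apply/funext => k; rewrite -[in LHS](posdef_inv (pS k)).1 mxE.
  have := @S_cvg j i; rewrite QE => Qji.
  exact: (cvg_unique (@Rhausdorff R) Qji (@S_cvg i j)).
apply: (ler_cvg_to (cvg_cst (0 : R)) (@form_cvg v v)).
by near=> k; have [_ ->] := posdef_psd (posdef_inv (pS k)).
Unshelve. all: by end_near. Qed.

(** Tested at [v *m invmx (S k)], both dominations involve [S k] only through its inverse, which
    converges. In the limit they become equality of two quadratic forms. *)
Lemma approx_limit_fixpoint : Q \in unitmx ->
  posdef (invmx Q) /\ scatter x (reg_h c1 c2 beta 1) (invmx Q) = invmx Q.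
Proof.
move=> uQ; have [sQ Q_ge0] := psdQ.
have pQ : posdef Q.
  split=> // v v0; rewrite -/(bform Q v v) lt_neqAle Q_ge0 andbT eq_sym.
  apply: contraNneq v0 => /(psd_isotropic psdQ) vQ.
  by rewrite -(mulmxK uQ v) vQ mul0mx.
have pQi := posdef_inv pQ; split=> //.
have g_cvg i : x i != 0 -> ((fun k => g k (t k i)) @ U -->
    reg_h c1 c2 beta 1 (bform Q (x i) (x i)))%classic.
  move=> xi; have t0 : 0 < bform Q (x i) (x i) by exact: pQ.2.
  apply: cvgD; apply: cvgMl_tmp; apply: cvg_powR => //; try exact: form_cvg.
    apply: cvgN; rewrite -[X in (_ --> X)%classic]subr0.
    by apply: cvgB => //; exact: cvg_cst.
  exact: cvg_cst.
pose L v := 2 / n%:R * \sum_i reg_h c1 c2 beta 1 (bform Q (x i) (x i)) *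
  (bform Q v (x i) * bform Q v (x i)).
have LE v : bform (scatter x (reg_h c1 c2 beta 1) (invmx Q)) (v *m Q) (v *m Q) = L v.
  by rewrite bform_scatter invmxK.
have lim_cvg v : ((fun k =>
    bform (scatter x (g k) (S k)) (v *m invmx (S k)) (v *m invmx (S k)))
    @ U --> L v)%classic.
  rewrite (funext (fun k => bform_scatter x (g k) (S k) _ _)).
  apply: cvgMl_tmp; apply: cvg_bigsum => i.
  have [xi|xi] := eqVneq (x i) 0.
    have dot0 w : (w *m (x i)^T) 0 0 = 0 by rewrite xi trmx0 mulmx0 mxE.
    rewrite /bform !dot0 !mulr0; under eq_fun do rewrite !dot0 !mulr0.
    exact: cvg_cst.
  apply: cvgM; first exact: g_cvg.
  by apply: cvgM; exact: (@form_cvg v (x i)).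
have form_invmx k v : bform (S k) (v *m invmx (S k)) (v *m invmx (S k))
    = bform (invmx (S k)) v v.
  rewrite bform_mulmxl bform_mulmxr trmx_invmx_sym ?((pS k).1)//.
  by rewrite mulVmx ?mul1mx//; exact: posdef_unit.
have e1_cvg : ((fun k => 1 + e k) @ U --> (1 : R))%classic.
  by rewrite -[X in (_ --> X)%classic]addr0; apply: cvgD => //; exact: cvg_cst.
apply: bform_inj; [exact: scatter_sym|exact: pQi.1|move=> w].
rewrite -(mulmxKV uQ w); set v := w *m invmx Q; rewrite LE.
have -> : bform (invmx Q) (v *m Q) (v *m Q) = bform Q v v.
  by rewrite bform_mulmxl bform_mulmxr sQ mulmxV// mul1mx.
apply/eqP; rewrite eq_le; apply/andP; split.
  rewrite -[leRHS]mul1r; apply: (ler_cvg_to (lim_cvg v)).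
    exact: cvgM e1_cvg (@form_cvg v v).
  by near=> k; rewrite /= -form_invmx; exact: domTS.
rewrite -[leRHS]mul1r; apply: (ler_cvg_to (@form_cvg v v)).
  exact: cvgM e1_cvg (lim_cvg v).
by near=> k; rewrite /= -form_invmx; exact: domST.
Unshelve. all: by end_near. Qed.


(* Suppose [Q] has kernel [L]. The weight [t * g t] of a point of [L] is asymptotically
   at most [c1]. A point outside [L] contributes nothing in the limit, since the
   compression to [L] only sees its component in [L], on which [Q] vanishes. Hence
   [n * \rank L <= 2 * c1 * #|{i | x i in L}|]. *)
Lemma approx_limit_unit : 2 * c1 < d%:R ->
  (forall L : 'M[R]_d, (1 <= \rank L)%N -> (\rank L < d)%N ->
     2 * c1 * (#|[set i : 'I_n | (x i <= L)%MS]|)%:R < n%:R * (\rank L)%:R) ->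
  Q \in unitmx.
Proof.
move=> c1d HL; apply: contraT => nuQ; pose L := kermx Q; pose B := row_base L.
have r_gt0 : (0 < \rank L)%N by rewrite lt0n mxrank_eq0 kermx_eq0 row_free_unit.
have fB : row_free B := row_base_free L.
pose A k := compression (S k) B.
have A_le k v : bform (A k) v v <= bform (invmx (S k)) v v by exact: compression_le.
(* Euclidean orthogonal projection onto [L]. *)
have proj (v : 'rV[R]_d) : exists2 l, (l <= L)%MS & B *m (v - l)^T = 0.
  have uB := posdef_unit (posdef_gram (posdef1 R d) fB).
  exists (v *m B^T *m invmx (B *m 1%:M *m B^T) *m B).
    by rewrite (submx_trans (submxMl _ _))// eq_row_base.
  apply: trmx_inj; rewrite trmx_mul trmxK trmx0 mulmxBl -(mulmxA _ B).
  by rewrite -{5}[B]mulmx1 mulmxKV// subrr.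
have t_cvg i : ((fun k => t k i) @ U --> bform Q (x i) (x i))%classic.
  exact: form_cvg.
have t_ge0 k i : 0 <= t k i by have [_] := posdef_psd (posdef_inv (pS k)); apply.
have F i : exists f : nat -> R,
    (f @ U --> (if (x i <= L)%MS then c1 else 0))%classic /\
    \forall k \near U, g k (t k i) * bform (A k) (x i) (x i) <= f k.
  have [xi|xi] := eqVneq (x i) 0.
    exists (fun=> if (x i <= L)%MS then c1 else 0); split; first exact: cvg_cst.
    apply: filterE => k.
    have -> : bform (A k) (x i) (x i) = 0 by rewrite xi /bform !mul0mx mxE.
    by rewrite mulr0; case: ifP.
  have t_gt0 k : 0 < t k i by exact: invmx_form_gt0.
  have [xL|xL] := ifPn.
    have tQ0 : bform Q (x i) (x i) = 0.
      by move/sub_kermxP: xL => xQ; rewrite /bform xQ mul0mx mxE.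
    have ti_cvg : ((fun k => t k i) @ U --> (0 : R))%classic by rewrite -tQ0.
    exists (fun k => c1 + c2 * t k i `^ beta); split.
      rewrite -[X in (_ --> X)%classic]addr0 -[X in (_ --> _ + X)%classic](mulr0 c2).
      apply: cvgD; [exact: cvg_cst|apply: cvgMl_tmp].
      exact: powR_cvg0_ge0.
    near=> k.
    apply: le_trans (_ : t k i * g k (t k i) <= _).
      by rewrite mulrC ler_wpM2r ?A_le// ltW// g_gt0.
    rewrite mul_reg_h// subKr lerD2r ler_piMr//.
    have p1 : 1 `^ e k = 1 :> R by rewrite powR1.
    rewrite -[leRHS]p1; apply: ge0_ler_powR; rewrite ?nnegrE ?(ltW (e_gt0 k))//.
    by rewrite -[t k i]ger0_norm//; near: k; exact: cvgr0_norm_le.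
  have Q_gt0 : 0 < bform Q (x i) (x i).
    rewrite lt_neqAle psdQ.2 andbT eq_sym.
    apply: contraNneq xL => /(psd_isotropic psdQ) xQ.
    exact/sub_kermxP.
  have [l lL Bl] := proj (x i).
  (* The weight is at most [n / t k i], with [t k i] tending to a positive limit, while the form at
     [l] tends to [bform Q l l = 0]. *)
  exists (fun k => n%:R * (t k i)^-1 * bform (invmx (S k)) l l); split.
    have l0 : bform Q l l = 0.
      by move/sub_kermxP: lL => lQ; rewrite /bform lQ mul0mx mxE.
    rewrite -[X in (_ --> X)%classic](mulr0 (n%:R * (bform Q (x i) (x i))^-1)) -l0.
    apply: cvgM; last exact: form_cvg.
    by apply: cvgMl_tmp; apply: cvgV; rewrite ?gt_eqF//; exact: t_cvg.
  apply: filterE => k.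
  have -> : bform (A k) (x i) (x i) = bform (A k) l l.
    by rewrite -{1 2}(subrK l (x i)) addrC compression_orth.
  apply: ler_pM => //; first exact/ltW/g_gt0.
  - exact: compression_ge0.
  - rewrite ler_pdivlMr// mulrC.
    exact: (scatter_weight_le (pS k) (@g_gt0 k) (e_le1 k)).
have /choice[f Hf] := F.
have trace_le k : (\rank L)%:R <= (1 + e k) *
    (2 / n%:R * \sum_i g k (t k i) * bform (A k) (x i) (x i)).
  rewrite -(mxtrace_compression_self (pS k) fB) -mxtrace_mul_scatter.
  apply: mxtrace_dominated => //; first exact: compression_ge0.
    by have [] := pS k.
  exact: scatter_sym.
have : (\rank L)%:R <= 1 * (2 / n%:R * \sum_i (if (x i <= L)%MS then c1 else 0)).
  have rhs_cvg : ((fun k => (1 + e k) * (2 / n%:R * \sum_i f i k)) @ U -->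
      1 * (2 / n%:R * \sum_i (if (x i <= L)%MS then c1 else 0)))%classic.
    apply: cvgM.
      by rewrite -[X in (_ --> X)%classic]addr0; apply: cvgD => //; exact: cvg_cst.
    by apply: cvgMl_tmp; apply: cvg_bigsum => i; exact: (Hf i).1.
  apply: (ler_cvg_to (cvg_cst _) rhs_cvg).
  have Hk : \forall k \near U, forall i, g k (t k i) * bform (A k) (x i) (x i) <= f i k.
    by apply: filter_forall => i; exact: (Hf i).2.
  near=> k; apply: le_trans (trace_le k) _.
  rewrite ler_wpM2l ?addr_ge0 ?(ltW (e_gt0 k))// ler_wpM2l ?divr_ge0//.
  apply: ler_sum => i _; move: i; near: k; exact: Hk.
rewrite mul1r -big_mkcond /= sumr_const -[c1 *+ _]mulr_natr => H.
have n_gt0 : 0 < n%:R :> R.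
  rewrite lt_neqAle ler0n andbT eq_sym; apply: contraTneq H => ->.
  by rewrite invr0 mulr0 mul0r -ltNge ltr0n.
have : n%:R * (\rank L)%:R <= 2 * c1 * #|[set i : 'I_n | (x i <= L)%MS]|%:R.
  rewrite cardsE mulrC -ler_pdivlMr//; apply: le_trans H _.
  by rewrite le_eqVlt; apply/orP; left; apply/eqP; ring.
apply: contraTT => _; rewrite -ltNge.
(* The subspace hypothesis excludes rank [d]; there [2 * c1 < d] and the count bound [n] suffice. *)
have := rank_leq_row L; rewrite leq_eqVlt => /orP[/eqP rd|rd]; last exact: HL.
rewrite rd; apply: le_lt_trans (_ : _ <= 2 * c1 * n%:R) _.
  rewrite ler_wpM2l ?mulr_ge0// ler_nat.
  by rewrite (leq_trans (max_card _))// card_ord.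
by rewrite mulrC ltr_pM2l.
Unshelve. all: by end_near. Qed.

End ApproximateFixpoints.

(** * Existence of a fixed point *)

Lemma scatter_fixpoint_exists (R : realType) (d n : nat) (x : 'I_n -> 'rV[R]_d)
    (c1 c2 beta : R) :
  \rank (\matrix_(i < n) x i) = d ->
  0 <= c1 -> 0 < c2 -> 0 < beta -> beta < 2 -> 2 * c1 < d%:R ->
  (forall L : 'M[R]_d, (1 <= \rank L)%N -> (\rank L < d)%N ->
     2 * c1 * (#|[set i : 'I_n | (x i <= L)%MS]|)%:R < n%:R * (\rank L)%:R) ->
  exists2 S, posdef S & scatter x (reg_h c1 c2 beta 1) S = S.
Proof.
move=> rank_x c1_ge0 c2_gt0 beta_gt0 beta_lt2 c1d HL.
pose e k : R := harmonic k; pose g k := reg_h c1 c2 beta (1 - e k).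
have e_gt0 k : 0 < e k by exact: harmonic_gt0.
have e_le1 k : e k <= 1 by rewrite invf_le1 ?ltr0n// ler1n.
have b1 : `|beta - 1| < 1.
  by rewrite ltr_norml ltrBlDr ltrBrDr addNr beta_gt0 -[1 + 1]/2.
have g_gt0 k t : 0 < t -> 0 < g k t by exact: reg_h_gt0.
have /choice[S HS] k : exists S, [/\ posdef S,
    dominated (1 + e k) (scatter x (g k) S) S &
    dominated (1 + e k) S (scatter x (g k) S)].
  apply: (@scatter_approx_fixpoint _ _ _ x rank_x (g k)
    (Num.max (1 - e k) `|beta - 1|)).
  - by rewrite le_max normr_ge0 orbT gt_max b1 andbT gtrBl e_gt0.
  - exact: e_gt0.
  - exact: g_gt0.
  move=> lam s t s0 t0 lam1 st ts; apply: reg_h_contraction => //.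
  - by rewrite subr_ge0.
  - by rewrite le_max lexx.
  - by rewrite le_max lexx orbT.
  - by rewrite ge_max (ltW b1) gerBl ltW.
have pS k : posdef (S k) by have [] := HS k.
have [U [UU subU]] := @ultraFilterLemma nat \oo%classic _.
have PU : ProperFilter U by exact: ultra_proper.
have t_le k i : bform (invmx (S k)) (x i) (x i) <= (n%:R / c2) `^ beta^-1.
  have [xi|xi] := eqVneq (x i) 0; first by rewrite xi /bform !mul0mx mxE powR_ge0.
  have [_ D _] := HS k.
  have := scatter_weight_le (pS k) (@g_gt0 k) (e_le1 k) D xi.
  have t0 := invmx_form_gt0 (pS k) xi; set t := bform _ _ _ in t0 *.
  rewrite mul_reg_h// => H.
  rewrite -[leLHS](powRr1 (ltW t0)) -{1}(mulfV (lt0r_neq0 beta_gt0)) powRrM.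
  apply: ge0_ler_powR; rewrite ?nnegrE ?powR_ge0 ?divr_ge0 ?invr_ge0
    ?(ltW beta_gt0) ?(ltW c2_gt0)//.
  rewrite ler_pdivlMr// mulrC; apply: le_trans H.
  by rewrite lerDr mulr_ge0// powR_ge0.
have [C HC] : exists C, forall k i j, `|invmx (S k) i j| <= C.
  exists (\tr (invmx (scatter x (fun=> 1) 1%:M)) *
    (2 / n%:R * \sum_(i < n) (n%:R / c2) `^ beta^-1)) => k i j.
  apply: le_trans (psd_entry_le_trace i j (posdef_psd (posdef_inv (pS k)))) _.
  apply: le_trans (invmx_mxtrace_le rank_x (pS k)) _.
  have pW : posdef (scatter x (fun=> 1) 1%:M).
    by apply: posdef_scatter => //; exact: posdef1.
  have trW : 0 <= \tr (invmx (scatter x (fun=> 1) 1%:M)).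
    rewrite -[invmx _]mulmx1; apply: mxtrace_psd_ge0 (posdef_psd (posdef1 R d)).
    exact: (posdef_psd (posdef_inv pW)).2.
  by rewrite ler_wpM2l// ler_wpM2l ?divr_ge0// ler_sum.
have entry_cvg (ij : 'I_d * 'I_d) : exists l : R,
    ((fun k => invmx (S k) ij.1 ij.2) @ U --> l)%classic.
  by apply: ultra_bounded_cvg => k; exact: HC.
have /choice[Q HQ] := entry_cvg.
have Q_cvg i j : ((fun k => invmx (S k) i j) @ U -->
    (\matrix_(i, j) Q (i, j)) i j)%classic.
  by rewrite mxE; exact: (HQ (i, j)).
have e_cvg : (e @ U --> (0 : R))%classic.
  by apply: cvg_trans cvg_harmonic => A hA; exact: subU.
have D1 k : dominated (1 + e k) (scatter x (g k) (S k)) (S k) by have [] := HS k.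
have D2 k : dominated (1 + e k) (S k) (scatter x (g k) (S k)) by have [] := HS k.
have uQ : \matrix_(i, j) Q (i, j) \in unitmx.
  exact: (approx_limit_unit c1_ge0 c2_gt0 beta_gt0 e_gt0 e_le1 e_cvg pS D1 D2
    Q_cvg c1d HL).
have [] := approx_limit_fixpoint e_cvg pS D1 D2 Q_cvg uQ.
by exists (invmx (\matrix_(i, j) Q (i, j))).
Qed.

(** * Application to the Kotz map *)

Lemma kotz_map_scatter (R : realType) (d n : nat) (alpha beta b : R)
    (x : 'I_n -> 'rV[R]_d) S : posdef S ->
  kotz_map alpha beta b x S =
  scatter x (reg_h (d%:R / 2 - alpha) (beta / b `^ beta) beta 1) S.
Proof.
move=> pS; congr (_ *: _); apply: eq_bigr => i _.
have [->|xi] := eqVneq (x i) 0; first by rewrite mulmx0 !scaler0.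
have t0 := invmx_form_gt0 pS xi.
by congr (_ *: _); rewrite /kotz_h /reg_h powR_inv1 ?ltW.
Qed.

Unset Implicit Arguments.

Theorem theorem47 (R : realType) (d n : nat) (alpha beta b : R)
  (x : 'I_n -> 'rV[R]_d) :
  0 < b -> 0 < beta -> beta < 2 -> 0 < alpha -> alpha <= d%:R / 2 ->
  (* x_1, ..., x_n span R^d *)
  \rank (\matrix_(i < n) x i) = d ->
  (* (d - 2 alpha) |{i : x_i in L}| < n d_L for every subspace L with 1 <= d_L < d *)
  (forall L : 'M[R]_d, (1 <= \rank L)%N -> (\rank L < d)%N ->
     (d%:R - 2 * alpha) * (#|[set i : 'I_n | (x i <= L)%MS]|)%:R
       < n%:R * (\rank L)%:R) ->
  exists Sstar : 'M[R]_d,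
    [/\ posdef Sstar,
        kotz_map alpha beta b x Sstar = Sstar,
        (forall S : 'M[R]_d, posdef S -> kotz_map alpha beta b x S = S -> S = Sstar) &
        (forall S0 : 'M[R]_d, posdef S0 ->
           mx_cvg_to (fun k => iter k (kotz_map alpha beta b x) S0) Sstar)].
Proof.
move=> b_gt0 beta_gt0 beta_lt2 alpha_gt0 alpha_le rank_x HL.
set c1 := d%:R / 2 - alpha; set c2 := beta / b `^ beta.
have c1_ge0 : 0 <= c1 by rewrite subr_ge0.
have c2_gt0 : 0 < c2 by rewrite divr_gt0// powR_gt0.
have c1E : 2 * c1 = d%:R - 2 * alpha by rewrite /c1; field.
(* Positivity of [alpha] supplies the strict inequality for the whole space. *)
have c1d : 2 * c1 < d%:R by rewrite c1E gtrBl mulr_gt0.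
have [|Sstar pS fS] :=
  scatter_fixpoint_exists rank_x c1_ge0 c2_gt0 beta_gt0 beta_lt2 c1d.
  by move=> L; rewrite c1E; exact: HL.
have g_gt0 t : 0 < t -> 0 < reg_h c1 c2 beta 1 t by exact: reg_h_gt0.
have S_cvg S0 : posdef S0 ->
    mx_cvg_to (fun k => iter k (kotz_map alpha beta b x) S0) Sstar.
  move=> pS0.
  have -> : (fun k => iter k (kotz_map alpha beta b x) S0)
      = (fun k => iter k (scatter x (reg_h c1 c2 beta 1)) S0).
    apply/funext => k; elim: k => [|k IHk]; first by [].
    rewrite !iterS IHk; apply: kotz_map_scatter.
    elim: k {IHk} => [|k IHk]; first exact: pS0.
    by rewrite iterS; exact: posdef_scatter.
  apply: scatter_iter_cvg => // m m0.
  exact: reg_h1_contraction.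
exists Sstar; split=> //; first by rewrite kotz_map_scatter.
(* The orbit of another fixed point is constant, yet converges to [Sstar]. *)
move=> S pS' fS'; apply/matrixP => i j.
apply: (cvg_unique (@Rhausdorff R) _ (S_cvg S pS' i j)).
have -> : (fun k => iter k (kotz_map alpha beta b x) S i j) = (fun=> S i j).
  by apply/funext => k; rewrite iter_fix.
exact: cvg_cst.
Qed.
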